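(* Assume (A1)–(A5). Then there exists $L>0$ such that for every sequence of minimizers $$(\mathbf c_n,\mathbf u_n)\in\operatorname*{arg\,min}_{(\mathbf c,\mathbf u)\in[0,\sqrt{nL}]^n\times\tilde{\mathcal B}^n}J_n(\mathbf c,\mathbf u),\qquad n\in\mathbb N,$$ the sequence of linear combinations $\frac1n\sum_{j=1}^n(c_n^j)^2u_n^j$ admits a weak$^*$-convergent subsequence in $\mathcal M$. Moreover, for every such weak$^*$-convergent subsequence (indexed by $n_k$) the weak$^*$-limit $$v_0=\lim_{k\to\infty}\frac1{n_k}\sum_{j=1}^{n_k}(c_{n_k}^j)^2u_{n_k}^j$$ satisfies $v_0\in\operatorname*{arg\,min}_{u\in\mathcal M}J(u)$.
   Context: Let $\mathcal C$ be a separable Banach space, $\mathcal M=\mathcal C^*$ its topological dual with the dual norm, and $Y$ a Hilbert space. Let $K:\mathcal M\to Y$, $\mathcal F:Y\to\mathbb R$, $\mathcal R:\mathcal M\to[0,+\infty]$ and $J(u):=\mathcal F(Ku)+\mathcal R(u)$ for $u\in\mathcal M$. Put $\mathrm{Dom}(\mathcal R):=\{u\in\mathcal M:\mathcal R(u)<+\infty\}$. Assumptions: (A1) $K$ is linear and weak$^*$-to-weak continuous. (A2) $\mathcal F$ is bounded from below, convex, and twice Fréchet differentiable on $Y$. (A3) $\mathcal R$ is convex, weak$^*$-lower semicontinuous and positively one-homogeneous: $\mathcal R(\lambda u)=\lambda\mathcal R(u)$ for all $\lambda\ge0$, $u\in\mathcal M$. (A4) For every $\alpha\ge0$ the sublevel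 set $\{u\in\mathcal M:\mathcal R(u)\le\alpha\}$ is weak$^*$-compact. (A5) $K$ is sequentially weak$^*$-to-strong continuous on $\mathrm{Dom}(\mathcal R)$. Let $B:=\{u\in\mathcal M:\mathcal R(u)\le1\}$, let $\mathrm{Ext}(B)$ be the set of its extremal points, and let $\tilde{\mathcal B}:=\overline{\mathrm{Ext}(B)}^{*}$ be the weak$^*$-closure of $\mathrm{Ext}(B)$. For $(\mathbf c,\mathbf u)=((c^1,\dots,c^n),(u^1,\dots,u^n))$ with $c^j\ge0$, $u^j\in\tilde{\mathcal B}$, set $J_n(\mathbf c,\mathbf u):=J\big(\frac1n\sum_{j=1}^n(c^j)^2u^j\big)$. *)

(* Defs.v *)
From HB Require Import structures.
From mathcomp Require Import all_boot all_order all_algebra.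
From mathcomp Require Import sesquilinear.
From mathcomp Require Import all_classical all_reals all_analysis.

Set Implicit Arguments.
Unset Strict Implicit.
Unset Printing Implicit Defensive.

Import Order.TTheory GRing.Theory Num.Theory.
Import numFieldNormedType.Exports.

Local Open Scope classical_set_scope.
Local Open Scope ring_scope.

Section Dual.
Context {R : realType} (V : normedModType R).

Definition dual_pred : {pred V -> R^o} :=
  mem [set f : V -> R^o | linear f /\ continuous f].

Record dual := Dual { dual_fun :> V -> R^o ; _ : dual_fun \in dual_pred }.

HB.instance Definition _ := [isSub for dual_fun].
HB.instance Definition _ := [Choice of dual by <:].

Fact dual_pred_submod : submod_closed dual_pred.
Proof.
split=> [|a f g]; rewrite !inE /=.
  split=> [k x y|]; first by rewrite scaler0 addr0.
  exact: cst_continuous.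
move=> [lf cf] [lg cg]; split=> [k x y|x].
  rewrite !fctE lf lg !scalerDr !scalerA (mulrC a) -!addrA; congr (_ + _).
  by rewrite addrCA.
by apply: cvgD; [apply: cvgZl_tmp; exact: cf|exact: cg].
Qed.

HB.instance Definition _ :=
  GRing.isSubmodClosed.Build R (V -> R^o) dual_pred dual_pred_submod.
HB.instance Definition _ := [SubChoice_isSubLmodule of dual by <:].

Fact dual_is_linear (f : dual) : linear f.
Proof. by case: f => f /=; rewrite inE => -[]. Qed.

HB.instance Definition _ (f : dual) :=
  GRing.isLinear.Build R V R^o *:%R f (@dual_is_linear f).

Fact dual_continuous (f : dual) : continuous f.
Proof. by case: f => f /=; rewrite inE => -[]. Qed.

Definition dual_norm (f : dual) : R :=
  sup [set `|f x| | x in [set x : V | `|x| <= 1]].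

Fact dual_has_sup (f : dual) :
  has_sup [set `|f x| | x in [set x : V | `|x| <= 1]].
Proof.
split; first by exists `|f 0|, 0 => //=; rewrite normr0.
have /bounded_funP/(_ 1)[M Mf] : bounded_near f (nbhs (0 : V)).
  by apply/linear_bounded_continuous; exact: dual_continuous.
by exists M => _ [x x1 <-]; exact: Mf.
Qed.

Fact dual_norm_ub (f : dual) (x : V) : `|x| <= 1 -> `|f x| <= dual_norm f.
Proof.
by move=> x1; apply: ub_le_sup; [case: (dual_has_sup f)|exists x].
Qed.

Fact dual_norm_le (f : dual) (M : R) :
  (forall x : V, `|x| <= 1 -> `|f x| <= M) -> dual_norm f <= M.
Proof.
move=> fM; apply: ge_sup; first by case: (dual_has_sup f).
by move=> _ [x x1 <-]; exact: fM.
Qed.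

Fact dual_normD (f g : dual) : dual_norm (f + g) <= dual_norm f + dual_norm g.
Proof.
apply: dual_norm_le => x x1; apply: le_trans (ler_normD (f x) (g x)) _.
by apply: lerD; exact: dual_norm_ub.
Qed.

Fact dual_normZ_le (k : R) (f : dual) :
  dual_norm (k *: f) <= `|k| * dual_norm f.
Proof.
apply: dual_norm_le => x x1; rewrite [X in `|X|](_ : _ = k * f x) // normrM.
by apply: ler_wpM2l => //; exact: dual_norm_ub.
Qed.

Fact dual_normZ (k : R) (f : dual) : dual_norm (k *: f) = `|k| * dual_norm f.
Proof.
have [->|k0] := eqVneq k 0.
  rewrite normr0 mul0r; apply/eqP; rewrite eq_le; apply/andP; split.
    by have := dual_normZ_le 0 f; rewrite normr0 mul0r.
  by apply: le_trans (dual_norm_ub (0 *: f) (x := 0) _); rewrite ?normr0.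
apply/eqP; rewrite eq_le dual_normZ_le /= -ler_pdivlMl ?normr_gt0// -normfV.
by apply: le_trans (dual_normZ_le _ _); rewrite scalerA mulVf// scale1r.
Qed.

Fact dual_norm_eq0 (f : dual) : dual_norm f = 0 -> f = 0.
Proof.
move=> f0; apply/val_inj/funext => x /=.
have [->|x0] := eqVneq x 0; first by rewrite linear0.
have /(dual_norm_ub f) : `| `|x|^-1 *: x | <= 1.
  by rewrite normrZ normfV normr_id mulVf// normr_eq0.
by rewrite f0 normr_le0 linearZ scaler_eq0 invr_eq0 normr_eq0 (negPf x0) => /eqP.
Qed.

HB.instance Definition _ :=
  Lmodule_isNormed.Build R dual dual_normD dual_normZ dual_norm_eq0.

(* [dual] itself carries the norm topology; the weak* topology lives on the
   alias [weak_star]. *)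
Definition weak_star : Type :=
  initial_topology (fun f : dual => (f : V -> R) : prod_topology (fun=> R)).
HB.instance Definition _ := Topological.on weak_star.

Definition weak : Type :=
  initial_topology (fun y : V => (fun f : dual => f y : R) :
                                   prod_topology (fun=> R)).
HB.instance Definition _ := Topological.on weak.

Definition weak_star_cvg (u : nat -> dual) (l : dual) : Prop :=
  (u : nat -> weak_star) @ \oo --> (l : weak_star).

Definition weak_star_closure (A : set dual) : set dual :=
  @closure weak_star A.

Definition weak_star_compact (A : set dual) : Prop := @compact weak_star A.

Definition weak_star_lsc (f : dual -> \bar R) : Prop :=
  @lower_semicontinuous weak_star R f.

End Dual.

Definition separable (T : topologicalType) : Prop :=
  exists2 D : set T, countable D & dense D.

Definition twice_frechet_differentiable {R : realType} (Y : normedModType R)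
    (F : Y -> R^o) : Prop :=
  exists2 dF : Y -> dual Y,
    forall y, is_diff y F (dF y) & forall y, differentiable dF y.

Definition econvex {R : realType} (V : lmodType R) (f : V -> \bar R) : Prop :=
  forall (t : R) (u v : V), 0 <= t <= 1 ->
    (f (t *: u + (1 - t) *: v)%R <= t%:E * f u + (1 - t)%:E * f v)%E.

(* Mathcomp has [0 * +oo = 0], so [l = 0] yields [f 0 = 0]. *)
Definition positively_homogeneous {R : realType} (V : lmodType R)
    (f : V -> \bar R) : Prop :=
  forall (l : R) (u : V), 0 <= l -> f (l *: u) = (l%:E * f u)%E.

Definition extremal_points {R : realType} (V : lmodType R) (B : set V) :
    set V :=
  [set u | B u /\ forall (v w : V) (t : R), B v -> B w -> 0 < t < 1 ->
                    u = t *: v + (1 - t) *: w -> v = u /\ w = u].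

Definition argmin {R : realType} (T : Type) (D : set T) (f : T -> \bar R) :
    set T :=
  [set x | D x /\ forall y, D y -> (f x <= f y)%E].

Section Problem.
Context {R : realType} (C Y : normedModType R).
Variables (K : dual C -> Y) (F : Y -> R) (Reg : dual C -> \bar R).

Definition edom : set (dual C) := [set u | (Reg u < +oo)%E].

Definition weak_star_to_weak_continuous : Prop :=
  continuous (K : weak_star C -> weak Y).

Definition seq_weak_star_to_strong_continuous_on (D : set (dual C)) : Prop :=
  forall (u : nat -> dual C) (l : dual C), (forall n, D (u n)) -> D l ->
    weak_star_cvg u l -> K \o u @ \oo --> K l.

Definition J (u : dual C) : \bar R := ((F (K u))%:E + Reg u)%E.

Definition unit_sublevel : set (dual C) := [set u | (Reg u <= 1)%E].

Definition Btilde : set (dual C) :=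
  weak_star_closure (extremal_points unit_sublevel).

Definition configuration (n : nat) : Type :=
  (('I_n -> R) * ('I_n -> dual C))%type.

Definition lincomb n (cu : configuration n) : dual C :=
  n%:R^-1 *: \sum_(j < n) (cu.1 j) ^+ 2 *: cu.2 j.

Definition Jn n (cu : configuration n) : \bar R := J (lincomb cu).

Definition feasible (L : R) n : set (configuration n) :=
  [set cu | forall j, 0 <= cu.1 j <= Num.sqrt (n%:R * L) /\ Btilde (cu.2 j)].

End Problem.

(* Main.v *)
Require Import Defs.
From HB Require Import structures.
From mathcomp Require Import all_boot all_order all_algebra.
From mathcomp Require Import sesquilinear ring lra.
From mathcomp Require Import all_classical all_reals all_analysis.

Set Implicit Arguments.
Unset Strict Implicit.
Unset Printing Implicit Defensive.

Import Order.TTheory GRing.Theory Num.Theory.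
Import numFieldNormedType.Exports.

Local Open Scope classical_set_scope.
Local Open Scope ring_scope.

(* Let [u] satisfy [Reg u < M]. Since [u / M] lies in the weak*-compact set
   [B = {Reg <= 1}], it is a weak*-limit of uniform averages
   [1/n (e_1 + ... + e_n)] of extremal points of [B]; taking [c_j = sqrt M] and
   [u_j = e_j] makes [M] times these averages admissible competitors, so
   [limsup J(v_n) <= F(K u) + M]. Lower semicontinuity of [Reg] and the
   continuity (A5) of [K] pass this bound to the limit of any subsequence of
   [v_n], and letting [M] decrease to [Reg u] yields [J v_0 <= J u]. Only those
   [u] with [J u <= J 0] matter, which bounds [Reg u] by [F 0 - inf F] and makes
   [L = F 0 - inf F + 1] large enough.
   The approximation by averages is a quantitative Krein-Milman theorem that
   needs no separation argument: greedily add an extremal point having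
   nonpositive inner product with the error accumulated so far. *)

(** * Cluster points of filters and dense sequences *)

Lemma cluster_image_cvg (T U : topologicalType) (F : set_system T) (f : T -> U)
    (p : T) (a : U) : Filter F -> hausdorff_space U -> continuous f ->
  cluster F p -> f @ F --> a -> f p = a.
Proof.
move=> FF hU cf; rewrite cluster_cvgE => -[G PG [Gp FG]] fa.
have fG : f @ G --> f p by apply: cvg_comp Gp (cf p).
apply: (@cvg_unique _ hU (f @ G)) fG _.
by apply: cvg_trans fa => A /=; apply: FG.
Qed.

(** If a neighborhood [U] of [l] were not in [F], the trace of [F] on the complement of [U] would be
    proper and cluster in [S], necessarily at [l], which [U] excludes. *)
Lemma compact_cvg_unique_cluster (T : topologicalType) (S : set T)
    (F : set_system T) (l : T) : compact S -> ProperFilter F -> F S ->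
  cluster F `<=` [set l] -> F --> l.
Proof.
move=> cS PF FS Fl U Ul; apply: contrapT => nFU.
have PG : ProperFilter (within (~` U) F).
  apply: Build_ProperFilter_ex => P /= FP; apply: contrapT => nP.
  apply: nFU; move: FP; rewrite /within /nbhs/=; apply: filterS => x UP.
  apply: contrapT => nU.
  by apply: nP; exists x; apply: UP.
have GS : within (~` U) F S by apply: filterS FS.
have [p [_ Gp]] := cS _ PG GS.
have pl : p = l by apply/Fl/(cvg_cluster _ Gp); exact: cvg_within.
have GnU : within (~` U) F (~` U) by apply: withinT.
by rewrite pl in Gp; have [x []] := Gp _ _ GnU Ul.
Qed.

Lemma separable_dense_seq (T : topologicalType) (x0 : T) :
  separable T -> exists d : nat -> T, dense (range d).
Proof.
move=> [D /pcard_leP/unsquash f dD].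
(* Indices that code no point of [D] take the default [x0]. *)
exists (fun n => xget x0 [set x | D x /\ f x = n]) => O O0 oO.
have [x [Ox Dx]] := dD O O0 oO; exists x; split => //; exists (f x) => //.
case: xgetP => [y _ [Dy fyx]|/(_ x) []//].
by have := 'inj_f; apply; rewrite ?inE.
Qed.

(** * Weak* convergence tested on a dense sequence *)

Section WeakStar.
Context {R : realType} {C : normedModType R}.
Implicit Types (u v w l : dual C) (S B : set (dual C)).

Lemma dual_scaleE u (a : R) (x : C) : u (a *: x) = a * u x :> R.
Proof. exact: linearZ. Qed.

Lemma sum_dualE (n : nat) (e : 'I_n -> dual C) (x : C) :
  dual_fun (\sum_(j < n) e j) x = \sum_(j < n) e j x :> R.
Proof. by apply: (big_morph (fun u : dual C => u x : R)). Qed.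

Lemma scale_dualE u (a : R) (x : C) : dual_fun (a *: u) x = a * u x :> R.
Proof. by []. Qed.

Lemma eval_continuous (x : C) :
  continuous ((fun u : dual C => u x) : weak_star C -> R).
Proof.
move=> u; apply: (@continuous_comp (weak_star C) _ R
  (fun f : dual C => (f : C -> R) : prod_topology (fun=> R)) (fun g => g x)).
  exact: initial_continuous.
exact: (@proj_continuous C (fun=> R) x).
Qed.

Lemma dual_eq_dense (d : nat -> C) u v :
  dense (range d) -> (forall i, u (d i) = v (d i)) -> u = v.
Proof.
move=> dd uv; apply/val_inj/funext => x /=; apply: contrapT => /eqP nx.
pose w := u - v.
have := dd (w @^-1` [set r : R | r != 0]); case.
- by exists x => /=; rewrite [X in X != _](_ : _ = u x - v x) // subr_eq0.
- by apply: open_comp => [y _|]; [exact: dual_continuous|exact: open_neq].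
- move=> y [+ [i _ yE]]; rewrite -yE /=.
  rewrite [X in X != _](_ : _ = u (d i) - v (d i)) //.
  by rewrite uv subrr eqxx.
Qed.

(** Compactness reduces convergence to uniqueness of the cluster point, and every cluster point
    agrees with [l] at each [d i]. *)
Lemma weak_star_cvg_dense (d : nat -> C) S (u : nat -> dual C) l :
  dense (range d) -> weak_star_compact S -> (forall n, S (u n)) ->
  (forall i, (fun n => u n (d i)) @ \oo --> l (d i)) -> weak_star_cvg u l.
Proof.
move=> dd cS Su ul; apply: (compact_cvg_unique_cluster cS).
  by exists 0 => // n _; exact: Su.
move=> p up; apply: (dual_eq_dense dd) => i.
apply: (@cluster_image_cvg (weak_star C) R _ (fun u : dual C => u (d i)) p _
  _ _ _ up); [exact: Rhausdorff|exact: eval_continuous|exact: ul].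
Qed.

(** A cluster point [l] is approached diagonally: at index [phi k] the first [k] coordinates are
    within [1/(k+1)] of those of [l]. *)
Lemma weak_star_compact_subsequence S (u : nat -> dual C) :
  separable C -> weak_star_compact S -> (forall n, S (u n)) ->
  exists phi : nat -> nat, increasing_seq phi /\
    exists l, weak_star_cvg (u \o phi) l.
Proof.
move=> /(separable_dense_seq 0)[d dd] cS Su.
have [l [_ ul]] : S `&` @cluster (weak_star C) (u @ \oo) !=set0.
  by apply: cS; exists 0 => // n _; exact: Su.
have next N k : exists n, (N < n)%N /\
    forall i : 'I_k, `|l (d i) - u n (d i)| < k.+1%:R^-1.
  have A : (u @ \oo) (u @` [set n | N < n]%N).
    by exists N.+1 => // n /= Nn; exists n.
  have B : \forall v \near (l : weak_star C),
      forall i : 'I_k, `|l (d i) - (v : dual C) (d i)| < k.+1%:R^-1.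
    apply: (@filter_forall _ _ _ _ (@nbhs_filter (weak_star C) l)) => i.
    have /cvgrPdist_lt := @eval_continuous (d i) l; apply.
    by rewrite invr_gt0.
  by have [_ [[n Nn <-] un]] := ul _ _ A B; exists n.
pose nx N k := sval (cid (next N k)).
pose phi := fix phi n := if n is m.+1 then nx (phi m) m.+1 else nx 0 0.
have phiS n : (phi n < phi n.+1)%N by rewrite /= /nx; case: cid => ? [].
exists phi; split; first exact/increasing_seqP.
exists l; apply: (weak_star_cvg_dense dd cS) => [n|i]; first exact: Su.
apply/cvgrPdist_lt => e e0; near=> n.
have phin k : forall i : 'I_k, `|l (d i) - u (phi k) (d i)| < k.+1%:R^-1.
  by case: k => [[]//|k]; rewrite /= /nx; case: cid => ? [].
have ni : (i < n)%N by near: n; exact: nbhs_infty_gt.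
apply: (lt_trans (phin n (Ordinal ni))).
near: n; exact: near_infty_natSinv_lt (PosNum e0).
Unshelve. all: end_near. Qed.


Lemma weak_star_hausdorff : hausdorff_space (weak_star C).
Proof.
move=> u v uv; apply/val_inj/funext => x; apply/esym.
apply: (@cluster_image_cvg (weak_star C) R _ (fun u : dual C => u x) v _
  _ _ _ uv); [exact: Rhausdorff|exact: eval_continuous|exact: eval_continuous].
Qed.

(** * Extremal points and their averages *)

Lemma eval_max B (x : C) : weak_star_compact B -> B !=set0 ->
  exists2 u, B u & forall v, B v -> v x <= u x.
Proof.
move=> cB B0.
have [|u /set_mem Bu uB] := @compact_EVT_max (weak_star C) R
  (fun u : dual C => u x) B B0 cB.
  by apply: continuous_subspaceT; exact: eval_continuous.
by exists u => // v Bv; apply: uB; exact: mem_set.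
Qed.

(* Maximize successively at [x] and at all points of a dense sequence: every
   step selects a compact face of the previous one, and the intersection of
   these faces is a single point. *)
Lemma extremal_point_max B (x : C) :
  separable C -> weak_star_compact B -> B !=set0 ->
  exists2 e, extremal_points B e & forall v, B v -> v x <= e x.
Proof.
move=> /(separable_dense_seq 0)[d dd] cB B0.
(* [x] comes first, so every point of [G 1], in particular [e], is a maximizer at [x]. *)
pose y n := if n is m.+1 then d m else x.
pose G := fix G n := if n is m.+1
  then [set u : dual C | G m u /\ forall v, G m v -> v (y m) <= u (y m)]
  else B.
have cG n : weak_star_compact (G n) /\ G n !=set0.
  elim: n => [//|n [cGn Gn0]].
  have [u Gu uG] := eval_max (y n) cGn Gn0.
  split; last by exists u.
  rewrite (_ : G n.+1 = G n `&` [set v : dual C | u (y n) <= v (y n)]).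
    apply: (@compact_closedI (weak_star C)) => //.
    apply: (@preimage_closed (weak_star C) R (fun v : dual C => v (y n))
      [set r | u (y n) <= r]); last exact: closed_ge.
    by move=> v _; exact: eval_continuous.
  apply/seteqP; split=> v /= [Gv vG]; split => //; first exact: vG.
  by move=> w Gw; apply: le_trans vG; exact: uG.
have GS n m : (n <= m)%N -> G m `<=` G n.
  by move=> /subnK <-; elim: (m - n)%N => [//|k IH] u /= [/IH].
have Gex n : exists u, G n u by have [_ [u]] := cG n; exists u.
have [g Gg] := choice Gex.
have [e [_ ge]] : B `&` @cluster (weak_star C) (g @ \oo) !=set0.
  by apply: cB; exists 0 => // n _; exact: (GS 0 n).
have Ge n : G n e.
  (* The tails of [g] lie in [G n], which is closed because it is compact in a Hausdorff space. *)
  apply: (compact_closed weak_star_hausdorff (cG n).1) => U Ue.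
  by apply: ge => //; exists n => // m /= nm; exact: (GS n m).
exists e; last by have /= [_] := Ge 1.
split; first exact: (Ge 0).
move=> v w t Bv Bw /andP[t0 t1] evw.
have e_at z : e z = t * v z + (1 - t) * w z by rewrite {1}evw.
(* A strict convex combination of values not exceeding the maximum attains it only if both values
   do. *)
have face n : G n v -> G n w -> v (y n) = e (y n) /\ w (y n) = e (y n).
  move=> Gv Gw; have /= [_ eG] := Ge n.+1.
  by have := eG _ Gv; have := eG _ Gw; rewrite e_at; nra.
have Gvw n : G n v /\ G n w.
  elim: n => [//|n [Gv Gw]]; have [ve we] := face n Gv Gw.
  by have /= [_ eG] := Ge n.+1; rewrite /= ve we.
by split; apply: (dual_eq_dense dd) => i; have [Gv Gw] := Gvw i.+1;
  have /= [] := face i.+1 Gv Gw.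
Qed.

(* Each new extremal point is chosen with nonpositive inner product against the
   accumulated error, so the squared errors only add up (Maurey's estimate). *)
Lemma sum_extremal_points B b (k : nat) (x : nat -> C) (D : R) (n : nat) :
  separable C -> weak_star_compact B -> B b ->
  (forall u, B u -> \sum_(i < k) (u (x i) - b (x i)) ^+ 2 <= D) ->
  exists e : nat -> dual C, (forall j, extremal_points B (e j)) /\
    \sum_(i < k) (\sum_(j < n) (e j (x i) - b (x i))) ^+ 2 <= n%:R * D.
Proof.
move=> sC cB Bb uD; have B0 : B !=set0 by exists b.
elim: n => [|n [e [Be eD]]].
  have [e Be _] := extremal_point_max 0 sC cB B0.
  exists (fun=> e); split => //.
  by rewrite mul0r big1// => i _; rewrite big_ord0 expr0n.
pose S i : R := \sum_(j < n) (e j (x i) - b (x i)).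
(* Maximizing at minus this combination minimizes the inner product with the error [S]; comparison
   with [b] shows that the minimum is nonpositive. *)
have [f Bf fmax] := extremal_point_max (- \sum_(i < k) S i *: x i) sC cB B0.
have Sf : \sum_(i < k) S i * (f (x i) - b (x i)) <= 0.
  have := fmax _ Bb; rewrite !linearN lerN2 !linear_sum /= -subr_le0 -sumrB.
  apply: le_trans; apply: ler_sum => i _.
  by rewrite !dual_scaleE mulrBr.
exists (fun j => if (j < n)%N then e j else f); split=> [j|].
  by case: ifP.
under eq_bigr => i _.
  rewrite big_ord_recr /= ltnn (eq_bigr (fun j : 'I_n => e j (x i) - b (x i))).
    rewrite -/(S i) sqrrD mulr2n; over.
  by move=> j _; rewrite ltn_ord.
rewrite !big_split /= -natr1 mulrDl mul1r; apply: lerD (uD _ Bf.1).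
by apply: le_trans eD; rewrite gerDl; lra.
Qed.

Lemma sum_geometric_half_le1 (k : nat) : \sum_(i < k) 2^-1 ^+ i.+1 <= 1 :> R.
Proof.
suff -> : \sum_(i < k) 2^-1 ^+ i.+1 = 1 - 2^-1 ^+ k :> R.
  by rewrite gerBl exprn_ge0.
elim: k => [|k IH]; first by rewrite big_ord0 expr0 subrr.
by rewrite big_ord_recr /= IH exprS; lra.
Qed.

(** In the application [z] is the error of an average of [N] points in a coordinate rescaled by [m];
    the first bound amounts to [|z| <= 1 / (m sqrt N)]. *)
Lemma norm_lt_of_sqr_mul_le (m N z eps : R) : 0 < m -> 0 < eps ->
  (m * N * z) ^+ 2 <= N -> (m * eps) ^- 2 < N -> `|z| < eps.
Proof.
move=> m0 eps0 zN epsN; have me0 : 0 < (m * eps) ^+ 2.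
  by rewrite exprn_gt0// mulr_gt0.
have N0 : 0 < N by apply: lt_trans epsN; rewrite invr_gt0.
have {}epsN : 1 < N * (m * eps) ^+ 2 by rewrite -ltr_pdivrMr// mul1r.
rewrite ltNge; apply/negP => epsz.
have {}epsz : eps ^+ 2 <= z ^+ 2.
  by rewrite -(real_normK (num_real z)) lerXn2r// nnegrE ltW.
suff : N * (m * eps) ^+ 2 <= 1 by rewrite leNgt epsN.
rewrite -(ler_pM2l N0) mulr1; apply: le_trans zN.
have -> : N * (N * (m * eps) ^+ 2) = (m * N) ^+ 2 * eps ^+ 2 by ring.
by rewrite [leRHS]exprMn ler_wpM2l// sqr_ge0.
Qed.

(* The points [d i] are rescaled so that, for every [n], all of [B] lies within
   distance 1 of [b] in the first [n] coordinates; the squared error of the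
   [n]-th average in these coordinates is then at most [1 / n.+1]. *)
Lemma cvg_average_extremal_points B b (d : nat -> C) :
  separable C -> weak_star_compact B -> B b ->
  exists e : nat -> nat -> dual C, (forall n j, extremal_points B (e n j)) /\
    forall i,
      (fun n => dual_fun (n.+1%:R^-1 *: \sum_(j < n.+1) e n j) (d i)) @ \oo
        --> b (d i).
Proof.
move=> sC cB Bb.
have bnd i : exists M : R, 0 < M /\
    forall u, B u -> M * `|u (d i) - b (d i)| <= 2^-1 ^+ i.+1.
  have B0 : B !=set0 by exists b.
  have [p Bp pB] := eval_max (d i) cB B0.
  have [q Bq qB] := eval_max (- d i) cB B0.
  (* [p] and [q] realize the extreme values at [d i]; the added 1 keeps [N] positive when these
     coincide. *)
  pose N := 1 + (p (d i) - b (d i)) + (b (d i) - q (d i)).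
  have pb := pB _ Bb.
  have qb := qB _ Bb; rewrite !linearN lerN2 in qb.
  have N0 : 0 < N by rewrite /N; lra.
  exists (2^-1 ^+ i.+1 / N); split; first by rewrite divr_gt0// exprn_gt0.
  move=> u Bu; have pu := pB _ Bu.
  have qu := qB _ Bu; rewrite !linearN lerN2 in qu.
  rewrite mulrAC -mulrA ler_piMr ?exprn_ge0// ler_pdivrMr// mul1r.
  by rewrite ler_norml /N; apply/andP; split; lra.
have {bnd}[M MB] := choice bnd.
have ex n : exists e : nat -> dual C, (forall j, extremal_points B (e j)) /\
    \sum_(i < n) (\sum_(j < n.+1) (e j (M i *: d i) - b (M i *: d i))) ^+ 2
      <= n.+1%:R * 1.
  apply: (@sum_extremal_points B b n (fun i => M i *: d i)) => // u Bu.
  apply: le_trans (sum_geometric_half_le1 n); apply: ler_sum => i _.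
  have [M0 /(_ _ Bu) Mu] := MB i.
  rewrite !dual_scaleE -mulrBr -real_normK ?num_real// normrM gtr0_norm//.
  (* A rescaled distance is at most 1, so its square is at most the distance itself. *)
  have h1 : 2^-1 ^+ i.+1 <= 1 :> R by rewrite exprn_ile1// invf_le1 ?ler1n.
  rewrite expr2; apply: le_trans (ler_piMl _ (le_trans Mu h1)) Mu.
  by rewrite mulr_ge0// ltW.
have {ex}[e eB] := choice ex.
exists e; split=> [n|i]; first by have [] := eB n.
apply/cvgrPdist_lt => eps eps0; near=> n.
have [M0 _] := MB i.
pose w : dual C := n.+1%:R^-1 *: \sum_(j < n.+1) e n j.
change (`|(b (d i) - w (d i) : R)| < eps).
have wE : w (d i) = n.+1%:R^-1 * \sum_(j < n.+1) e n j (d i) :> R.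
  by rewrite /w scale_dualE sum_dualE.
clearbody w.
have ni : (i < n)%N by near: n; exact: nbhs_infty_gt.
(* Of the sum of squares only the [i]-th term is kept, which is present once [n > i]. *)
have wb : (M i * n.+1%:R * (w (d i) - b (d i))) ^+ 2 <= n.+1%:R.
  have [_] := eB n; rewrite mulr1 (bigD1 (Ordinal ni)) //=; apply: le_trans.
  rewrite -[leLHS]addr0; apply: lerD; last first.
    by apply: sumr_ge0 => j _; rewrite sqr_ge0.
  rewrite le_eqVlt; apply/orP; left; apply/eqP; congr (_ ^+ 2).
  under [RHS]eq_bigr do rewrite !dual_scaleE -mulrBr.
  rewrite -mulr_sumr sumrB sumr_const card_ord -[b _ *+ _]mulr_natl -mulrA.
  congr (_ * _).
  by rewrite wE mulrBr mulrA mulfV ?pnatr_eq0// mul1r.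
rewrite distrC; apply: (norm_lt_of_sqr_mul_le M0 eps0 wb).
by rewrite -natr1 ltr_wpDr//; near: n; exact: nbhs_infty_gtr.
Unshelve. all: end_near. Qed.

End WeakStar.

(** * Limits along subsequences and lower semicontinuity *)

Lemma increasing_seq_cvg (phi : nat -> nat) :
  increasing_seq phi -> phi @ \oo --> \oo.
Proof.
move=> phi_incr; have le_phi n : (n <= phi n)%N.
  elim: n => // n /leq_ltn_trans; apply.
  by move/increasing_seqP : phi_incr; apply.
apply/cvgnyPge => N; near=> n; apply: leq_trans (le_phi n).
by near: n; exact: nbhs_infty_ge.
Unshelve. all: end_near. Qed.

Lemma weak_star_lsc_cvg_le (R : realType) (C : normedModType R)
    (f : dual C -> \bar R) (u : nat -> dual C) (l : dual C) (r : R) :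
  weak_star_lsc f -> weak_star_cvg u l ->
  (\forall n \near \oo, (f (u n) <= r%:E)%E) -> (f l <= r%:E)%E.
Proof.
move=> lscf ul ur; rewrite leNgt; apply/negP => /lscf[V Vl Vr].
have uV : \forall n \near \oo, V (u n) by exact: ul.
have [n [Vn]] := filter_ex (filterI uV ur).
by rewrite leNgt (Vr _ Vn).
Qed.

(** * Sublinearity from convexity and homogeneity *)

Section Sublinear.
Context {R : realType} {V : lmodType R} (f : V -> \bar R).
Hypotheses (fc : econvex f) (fh : positively_homogeneous f).

Lemma positively_homogeneous0 : f 0 = 0%E.
Proof. by rewrite -[in LHS](scale0r 0) fh// mul0e. Qed.

Lemma positively_homogeneous_scale_le (a r : R) u :
  0 <= a -> (f u <= r%:E)%E -> (f (a *: u) <= (a * r)%:E)%E.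
Proof. by move=> a0 ur; rewrite fh// EFinM lee_wpmul2l ?lee_fin. Qed.

(** The sum is twice a midpoint: convexity bounds the midpoint and homogeneity restores the
    factor. *)
Lemma sublinear_add_le (r s : R) u v : (f u <= r%:E)%E -> (f v <= s%:E)%E ->
  (f (u + v) <= (r + s)%:E)%E.
Proof.
move=> ur vs; have half : (0 <= 2^-1 :> R) && (2^-1 <= 1 :> R).
  by apply/andP; split; lra.
have -> : u + v = 2 *: (2^-1 *: u + (1 - 2^-1) *: v).
  rewrite scalerDr !scalerA mulfV ?pnatr_eq0// mulrBr mulr1 mulfV ?pnatr_eq0//.
  by rewrite !(scale1r, addrK).
have -> : r + s = 2 * (2^-1 * r + (1 - 2^-1) * s) by field.
apply: positively_homogeneous_scale_le => //; apply: le_trans (fc u v half) _.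
by rewrite [leRHS]EFinD !EFinM; apply: leeD; rewrite lee_wpmul2l// lee_fin; lra.
Qed.

Lemma sublinear_sum_le (n : nat) (e : 'I_n -> V) :
  (forall j, (f (e j) <= 1%:E)%E) -> (f (\sum_(j < n) e j) <= n%:R%:E)%E.
Proof.
elim: n e => [|n IH] e e1; first by rewrite big_ord0 positively_homogeneous0.
by rewrite big_ord_recr -natr1; apply: sublinear_add_le => //; exact: IH.
Qed.

Lemma sublinear_average_le1 (n : nat) (e : 'I_n.+1 -> V) :
  (forall j, (f (e j) <= 1%:E)%E) ->
  (f (n.+1%:R^-1 *: \sum_(j < n.+1) e j) <= 1%:E)%E.
Proof.
move=> e1; have -> : 1%:E = (n.+1%:R^-1 * n.+1%:R)%:E :> \bar R.
  by rewrite mulVf ?pnatr_eq0.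
by apply: positively_homogeneous_scale_le => //; exact: sublinear_sum_le.
Qed.

End Sublinear.

(** * Competitors and passage to the limit *)

Section Problem.
Context {R : realType} {C Y : normedModType R}.
Variables (K : {linear dual C -> Y}) (F : Y -> R) (Reg : dual C -> \bar R).
Hypotheses (sepC : separable C) (Reg_ge0 : forall u, (0 <= Reg u)%E).
Hypotheses (F_continuous : continuous F).
Hypotheses (Reg_convex : econvex Reg) (Reg_lsc : weak_star_lsc Reg).
Hypotheses (Reg_homogeneous : positively_homogeneous Reg).
Hypotheses (Reg_compact : forall a : R, 0 <= a ->
  weak_star_compact [set u : dual C | (Reg u <= a%:E)%E]).
Hypotheses
  (K_continuous : seq_weak_star_to_strong_continuous_on K (edom Reg)).

(** The common bound [r] keeps the sequence and its limit in [edom Reg], where [K_continuous]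
    applies. *)
Lemma cvg_FK (u : nat -> dual C) l (r : R) :
  (forall n, (Reg (u n) <= r%:E)%E) -> (Reg l <= r%:E)%E ->
  weak_star_cvg u l -> (fun n => F (K (u n))) @ \oo --> F (K l).
Proof.
move=> ur lr ul; have Kul : K \o u @ \oo --> K l.
  apply: K_continuous => // [n|]; last exact: le_lt_trans lr (ltry _).
  exact: le_lt_trans (ur n) (ltry _).
exact: (cvg_comp _ _ Kul (@F_continuous (K l))).
Qed.

Lemma weak_star_cvg_average_extremal_points (M : R) u :
  0 < M -> (Reg u <= M%:E)%E ->
  exists e : nat -> nat -> dual C,
    (forall n j, extremal_points (unit_sublevel Reg) (e n j)) /\
    let w n := M *: (n.+1%:R^-1 *: \sum_(j < n.+1) e n j) in
    (forall n, (Reg (w n) <= M%:E)%E) /\ weak_star_cvg w u.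
Proof.
move=> M0 uM; have [d dd] := separable_dense_seq 0 sepC.
have Bu : unit_sublevel Reg (M^-1 *: u).
  rewrite /unit_sublevel/=; have -> : 1%E = (M^-1 * M)%:E.
    by rewrite mulVf ?gt_eqF.
  by apply: positively_homogeneous_scale_le => //; rewrite invr_ge0 ltW.
have [e [Be eu]] := cvg_average_extremal_points d sepC (Reg_compact ler01) Bu.
exists e; split=> // w.
have wM n : (Reg (w n) <= M%:E)%E.
  rewrite -[M]mulr1; apply: positively_homogeneous_scale_le => //.
    exact: ltW.
  by apply: sublinear_average_le1 => // j; have [] := Be n j.
split=> //; apply: (weak_star_cvg_dense dd (Reg_compact (ltW M0))) => // i.
have -> : u (d i) = M * dual_fun (M^-1 *: u) (d i).
  by rewrite scale_dualE mulrA mulfV ?gt_eqF// mul1r.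
exact: (@cvgM R nat \oo _ (fun=> M) _ _ _ (cvg_cst M) (eu i)).
Qed.

Lemma argmin_le_average (L M : R) n (cu : configuration C n.+1)
    (e : nat -> dual C) :
  argmin (@feasible R C Reg L n.+1) (@Jn R C Y K F Reg n.+1) cu ->
  0 <= M <= L -> (forall j, extremal_points (unit_sublevel Reg) (e j)) ->
  (J K F Reg (lincomb cu) <=
   J K F Reg (M *: (n.+1%:R^-1 *: \sum_(j < n.+1) e j)))%E.
Proof.
move=> [_ cu_min] /andP[M0 ML] Be.
have := cu_min (fun=> Num.sqrt M, fun j : 'I_n.+1 => e j).
rewrite /Jn /lincomb /= (sqr_sqrtr M0) -scaler_sumr scalerA mulrC -scalerA.
apply=> j /=; split; last exact: subset_closure.
rewrite sqrtr_ge0 ler_wsqrtr//; apply: (le_trans ML).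
by apply: ler_peMl; [exact: le_trans ML|rewrite ler1n].
Qed.

Lemma argmin_le0 (L : R) n (cu : configuration C n.+1) :
  argmin (@feasible R C Reg L n.+1) (@Jn R C Y K F Reg n.+1) cu ->
  (J K F Reg (lincomb cu) <= (F 0)%:E)%E.
Proof.
move=> [cu_feas cu_min].
(* The competitor has zero coefficients and the atoms of [cu], already known to lie in [Btilde]. *)
have cu0 : lincomb (fun=> 0, cu.2) = 0.
  by rewrite /lincomb big1 ?scaler0// => j _; rewrite /= expr0n scale0r.
have := cu_min (fun=> 0, cu.2); rewrite /Jn cu0 [X in (_ <= X)%E]/J linear0.
rewrite positively_homogeneous0// adde0.
by apply=> j /=; split; [rewrite lexx sqrtr_ge0|have [] := cu_feas j].
Qed.

Lemma J_le_Reg u (r : R) :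
  (J K F Reg u <= r%:E)%E = (Reg u <= (r - F (K u))%:E)%E.
Proof. by rewrite /J EFinB leeBrDl. Qed.

Lemma J_limit_le (L : R) (cu : forall n, configuration C n.+1)
    (phi : nat -> nat) v0 (A M : R) u :
  (forall n, argmin (@feasible R C Reg L n.+1)
               (@Jn R C Y K F Reg n.+1) (cu n)) ->
  (forall n, (Reg (lincomb (cu n)) <= A%:E)%E) ->
  increasing_seq phi ->
  weak_star_cvg ((fun n => lincomb (cu n)) \o phi) v0 ->
  0 < M <= L -> (Reg u <= M%:E)%E ->
  (J K F Reg v0 <= (F (K u) + M)%:E)%E.
Proof.
move=> cu_min vA phi_incr v_cvg /andP[M0 ML] uM.
have [e [Be [wM w_cvg]]] := weak_star_cvg_average_extremal_points M0 uM.
have v0A : (Reg v0 <= A%:E)%E.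
  by apply: (weak_star_lsc_cvg_le Reg_lsc v_cvg); near=> n; exact: vA.
have Fv := cvg_FK (fun n => vA (phi n)) v0A v_cvg.
(* The averages are taken along [phi] too, so that minimizer and competitor have equally many
   atoms. *)
have Fw := cvg_comp _ _ (increasing_seq_cvg phi_incr) (cvg_FK wM uM w_cvg).
(* Moving [F (K v0)] to the right leaves a bound on [Reg v0], obtained from lower semicontinuity;
   each of the two limits of [F] costs [eps / 2]. *)
apply/lee_addgt0Pr => eps eps0; rewrite -EFinD J_le_Reg.
apply: (weak_star_lsc_cvg_le Reg_lsc v_cvg); near=> n.
have Fvn : `|F (K v0) - F (K (lincomb (cu (phi n))))| < eps / 2.
  by near: n; move/cvgrPdist_lt : Fv; apply; rewrite divr_gt0.
have Fwn : `|F (K u) - F (K (M *: ((phi n).+1%:R^-1 *: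
    \sum_(j < (phi n).+1) e (phi n) j)))| < eps / 2.
  by near: n; move/cvgrPdist_lt : Fw; apply; rewrite divr_gt0.
have := argmin_le_average (cu_min (phi n)) _ (Be (phi n)).
move=> /(_ M); rewrite (ltW M0) ML => /(_ isT) vw.
have {vw} := le_trans vw (leeD (lexx _) (wM (phi n))).
rewrite -EFinD J_le_Reg => /le_trans; apply; rewrite lee_fin.
by move: Fvn Fwn; rewrite !ltr_norml => /andP[? ?] /andP[? ?]; lra.
Unshelve. all: end_near. Qed.

Lemma argmin_subseq_limit (lb : R) (cu : forall n, configuration C n.+1) :
  (forall y, lb <= F y) ->
  (forall n, argmin (@feasible R C Reg (F 0 - lb + 1) n.+1)
               (@Jn R C Y K F Reg n.+1) (cu n)) ->
  let v n := lincomb (cu n) in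
  (exists phi : nat -> nat, increasing_seq phi /\
     exists v0, weak_star_cvg (v \o phi) v0) /\
  (forall (phi : nat -> nat) (v0 : dual C), increasing_seq phi ->
     weak_star_cvg (v \o phi) v0 -> argmin setT (J K F Reg) v0).
Proof.
move=> Flb cu_min v.
have Reg_le u : (J K F Reg u <= (F 0)%:E)%E -> (Reg u <= (F 0 - lb)%:E)%E.
  by rewrite J_le_Reg => /le_trans; apply; rewrite lee_fin lerB.
have vA n : (Reg (v n) <= (F 0 - lb)%:E)%E.
  by apply/Reg_le/argmin_le0; exact: cu_min.
have A0 : 0 <= F 0 - lb by rewrite subr_ge0.
split; first exact: (weak_star_compact_subsequence sepC (Reg_compact A0) vA).
move=> phi v0 phi_incr v_cvg; split=> // u _.
have J_le w (r : R) : 0 <= r <= F 0 - lb -> (Reg w <= r%:E)%E ->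
    (J K F Reg v0 <= (F (K w) + r)%:E)%E.
  move=> /andP[r0 rA] wr; apply/lee_addgt0Pr => eps eps0.
  (* [J_limit_le] requires a positive [M], even for [r = 0]; [eta <= 1] keeps [r + eta] below [L],
     whence the [+ 1] in [L]. *)
  pose eta := Num.min eps 1.
  have eta0 : 0 < eta by rewrite lt_min eps0 ltr01.
  have := J_limit_le cu_min vA phi_incr v_cvg (u := w) (M := r + eta).
  have -> : 0 < r + eta <= F 0 - lb + 1.
    by rewrite ltr_wpDl//= lerD// ge_min lexx orbT.
  move=> /(_ isT) J_eta; apply: le_trans (J_eta _) _.
    by apply: le_trans wr _; rewrite lee_fin lerDl ltW.
  by rewrite -EFinD lee_fin addrA lerD2l ge_min lexx.
have J0 : (J K F Reg v0 <= (F 0)%:E)%E.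
  have := J_le 0 0; rewrite linear0 addr0 lexx A0; apply => //.
  by rewrite positively_homogeneous0.
(* If [J u >= F 0] the bound [J0] suffices; otherwise [Reg u] is finite and [J_le] applies with
   [r = Reg u]. *)
have [|uF0] := leP (F 0)%:E (J K F Reg u); first exact: le_trans.
have uA := Reg_le _ (ltW uF0).
have Reg_fin : Reg u \is a fin_num.
  by rewrite ge0_fin_numE//; exact: le_lt_trans uA (ltry _).
rewrite [leRHS]/J -(fineK Reg_fin) -EFinD; apply: J_le; last by rewrite fineK.
by rewrite fine_ge0//= -lee_fin fineK.
Qed.

End Problem.

(* The number of atoms is n >= 1, so the n-th term of the
   sequences below is the problem with n.+1 atoms. *)
Theorem proposition3p7 (R : realType) (C Y : completeNormedModType R)
    (ip : {dot Y for (@idfun R)})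
    (K : {linear dual C -> Y}) (F : Y -> R) (Reg : dual C -> \bar R)
    (sepC : separable C)
    (hilbertY : forall y : Y, ip y y = `|y| ^+ 2)
    (Reg_ge0 : forall u, (0 <= Reg u)%E)
    (A1 : weak_star_to_weak_continuous K)
    (A2_bounded_below : has_lbound (range F))
    (A2_convex : convex_function setT (F : convex_lmodType Y -> R^o))
    (A2_diff : twice_frechet_differentiable F)
    (A3_convex : econvex Reg)
    (A3_lsc : weak_star_lsc Reg)
    (A3_homogeneous : positively_homogeneous Reg)
    (A4 : forall a : R, 0 <= a ->
            weak_star_compact [set u : dual C | (Reg u <= a%:E)%E])
    (A5 : seq_weak_star_to_strong_continuous_on K (edom Reg)) :
  exists2 L : R, 0 < L &
    forall cu : (forall n, configuration C n.+1),
      (forall n, argmin (@feasible R C Reg L n.+1) (@Jn R C Y K F Reg n.+1)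
                   (cu n)) ->
      let v (n : nat) : dual C := lincomb (cu n) in
      (exists phi : nat -> nat, increasing_seq phi /\
         exists v0, weak_star_cvg (v \o phi) v0) /\
      (forall (phi : nat -> nat) (v0 : dual C), increasing_seq phi ->
         weak_star_cvg (v \o phi) v0 -> argmin setT (J K F Reg) v0).
Proof.
have [lb Flb] := A2_bounded_below.
have {}Flb y : lb <= F y by apply: Flb; exists y.
have F_cont : continuous F.
  have [dF FdF _] := A2_diff.
  by move=> y; apply: differentiable_continuous; have [] := FdF y.
(* Any lower bound [lb] of [F] can stand for the infimum. *)
exists (F 0 - lb + 1); first by rewrite ltr_wpDl// subr_ge0.
move=> cu cu_min; exact: (argmin_subseq_limit sepC).
Qed.
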